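(* Let $r\geq 1$ be an integer. There exists $c_r<1$ such that the following holds for every $\alpha$ with $c_r\leq\alpha\leq 1$. Let $n$ be an integer such that $\alpha n$ is an integer. Then every $K_{r+1}$-free graph $G$ on $n$ vertices contains a set $A$ of $\alpha n$ vertices such that \[ e(A)+e(A^c)\leq \frac{r-1}{2r}(2\alpha-1)n^2. \]
   Context: For $A\subseteq V(G)$, $e(A)$ denotes the number of edges of $G$ with both endpoints in $A$, and $A^c=V(G)\setminus A$. $K_{r+1}$ denotes the complete graph on $r+1$ vertices. *)

(* Defs.v *)
From HB Require Import structures.
From mathcomp Require Import all_boot all_order all_algebra.
From mathcomp Require Import reals.

Set Implicit Arguments.
Unset Strict Implicit.
Unset Printing Implicit Defensive.

Record sgraph (T : finType) := SGraph {
  adj :> rel T;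
  adj_sym : symmetric adj;
  adj_irrefl : irreflexive adj
}.

(* An edge is the unordered pair of its endpoints. *)
Definition edges (T : finType) (G : sgraph T) : {set {set T}} :=
  [set f : {set T} | [exists x, exists y, G x y && (f == [set x; y])]].

Definition edges_within (T : finType) (G : sgraph T) (A : {set T}) : nat :=
  #|[set f in edges G | f \subset A]|.

Definition complete_rel (k : nat) : rel 'I_k := fun i j => i != j.

Lemma complete_sym (k : nat) : symmetric (@complete_rel k).
Proof. by move=> i j; rewrite /complete_rel eq_sym. Qed.

Lemma complete_irrefl (k : nat) : irreflexive (@complete_rel k).
Proof. by move=> i; rewrite /complete_rel eqxx. Qed.

Definition complete_graph (k : nat) : sgraph 'I_k :=
  SGraph (@complete_sym k) (@complete_irrefl k).

(* Subgraphs are not required to be induced. *)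
Definition contains_copy (S T : finType) (H : sgraph S) (G : sgraph T) : Prop :=
  exists f : S -> T, injective f /\ forall x y, H x y -> G (f x) (f y).

Definition graph_free (S T : finType) (H : sgraph S) (G : sgraph T) : Prop :=
  ~ contains_copy H G.

(* Main.v *)
(* Write m = (1 - alpha) n and let D be the amount by which e(G) falls short of
   (r-1)/(2r) n^2. If D >= (r-1)/r m n, any set of m vertices can serve as the
   complement of A. Otherwise Füredi's proof of the stability of Turán's theorem
   partitions the vertices into r classes with at most D inner edges, hence with
   at most 2D missing edges between classes; since D is small all classes have
   nearly n/r vertices. Take as complement of A the m vertices of the smallest
   class V_i that miss the fewest edges to other classes: it sends at least
   m(n - |V_i|) - 4D m/|V_i| >= (r-1)/r m n - D edges to A, as |V_i| >= 4m. *)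
Require Import Defs.
From HB Require Import structures.
From mathcomp Require Import all_boot all_order all_algebra.
From mathcomp Require Import reals.
From mathcomp Require Import zify ring lra.
Set Implicit Arguments.
Unset Strict Implicit.
Unset Printing Implicit Defensive.
Import Order.TTheory GRing.Theory Num.Theory.
Local Open Scope ring_scope.

(** * Double counting and Füredi's colouring *)

Lemma sum_set2D (T : finType) (h : T -> T -> nat) (S N : {set T}) :
  (forall x y, h x y = h y x) -> N \subset S ->
  (\sum_(x in S) \sum_(y in S) h x y =
   \sum_(x in N) \sum_(y in N) h x y
   + (\sum_(x in S :\: N) \sum_(y in N) h x y).*2
   + \sum_(x in S :\: N) \sum_(y in S :\: N) h x y)%N.
Proof.
move=> hC NS.
have sumSN (F : T -> nat) :
  (\sum_(x in S) F x = \sum_(x in N) F x + \sum_(x in S :\: N) F x)%N.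
  by rewrite (big_setID N) /= (setIidPr NS).
rewrite sumSN; under eq_bigr do rewrite sumSN.
under [X in (_ + X)%N]eq_bigr do rewrite sumSN.
rewrite !big_split /= [X in (_ + X + _)%N]exchange_big /=.
under [X in (_ + X + _)%N]eq_bigr do under eq_bigr do rewrite hC.
lia.
Qed.

(* Füredi's argument: the non-neighbours of a vertex of maximum degree form one
   class, and its neighbourhood is coloured by induction. *)
Lemma coloring_of_clique_free (T : finType) (G : sgraph T) (r : nat) (S : {set T}) :
  (forall s, pairwise G s -> {subset s <= S} -> size s != r.+1) ->
  exists col : T -> nat, (forall x, x \in S -> (col x < r)%N) /\
    (\sum_(x in S) \sum_(y in S) G x y
     + \sum_(x in S) \sum_(y in S) (G x y && (col x == col y))
     <= \sum_(x in S) \sum_(y in S) (col x != col y))%N.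
Proof.
elim: r S => [|r IH] S free.
  exists (fun=> 0%N); have -> : S = set0.
    apply/setP => x; rewrite inE; apply/negbTE/negP => xS.
    have /(free [:: x] isT) // : {subset [:: x] <= S}.
    by move=> y; rewrite inE => /eqP ->.
  by split=> [x|]; rewrite ?inE // !big_set0.
have [->|[v0 v0S]] := set_0Vmem S.
  by exists (fun=> 0%N); split=> [x|]; rewrite ?inE // !big_set0.
pose deg x := (\sum_(y in S) G x y)%N.
have [v vS vmax] : exists2 v, v \in S & forall x, x \in S -> (deg x <= deg v)%N.
  by case: (@arg_maxnP _ v0 (mem S) deg v0S) => v; exists v.
pose N := [set y in S | G v y].
have NS : N \subset S by apply/subsetP => y; rewrite inE => /andP[].
have degN : deg v = #|N|.
  rewrite /deg -sum1_card big_mkcond /= [RHS]big_mkcond /=.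
  by apply: eq_bigr => y _; rewrite inE; case: (y \in S); case: (G v y).
have [s s_clique s_N|col0 [col0_lt col0_le]] := IH N.
  apply: (free (v :: s)) => [|y].
    rewrite /= s_clique andbT; apply/allP => y /s_N.
    by rewrite inE => /andP[].
  by rewrite inE => /orP[/eqP->//|/s_N]; rewrite inE => /andP[].
(* The non-neighbours of [v], including [v] itself, take the new colour [r]. *)
pose col x := if x \in N then col0 x else r.
have colN x : x \in N -> col x = col0 x by rewrite /col => ->.
have colV x : x \in S :\: N -> col x = r.
  by rewrite inE /col => /andP[/negbTE ->].
have colNV x y : x \in S :\: N -> y \in N -> (col x == col y) = false.
  move=> xV yN; rewrite (colV _ xV) (colN _ yN).
  by apply/negbTE; rewrite gtn_eqF // col0_lt.
exists col; split=> [x xS|].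
  by rewrite /col; case: ifP => // /col0_lt /ltnW.
have GC x y : G x y = G y x := adj_sym G x y.
rewrite !(sum_set2D _ NS);
  try by move=> x y; rewrite 1?GC 1?eq_sym.
rewrite [X in (_ <= X + _ + _)%N](eq_bigr
  (fun x => \sum_(y in N) (col0 x != col0 y))%N); last first.
  by move=> x xN; apply: eq_bigr => y yN; rewrite !colN.
rewrite [X in (_ + (X + _ + _) <= _)%N](eq_bigr
  (fun x => \sum_(y in N) (G x y && (col0 x == col0 y)))%N); last first.
  by move=> x xN; apply: eq_bigr => y yN; rewrite !colN.
rewrite [X in (_ + (_ + X.*2 + _) <= _)%N]big1; last first.
  by move=> x xV; apply: big1 => y yN; rewrite colNV // andbF.
rewrite [X in (_ + (_ + _ + X) <= _)%N](eq_bigr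
  (fun x => \sum_(y in S :\: N) G x y)%N); last first.
  by move=> x xV; apply: eq_bigr => y yV; rewrite !colV // eqxx andbT.
rewrite [X in (_ <= _ + X.*2 + _)%N](eq_bigr (fun=> #|N|)); last first.
  move=> x xV; rewrite -sum1_card; apply: eq_bigr => y yN.
  by rewrite colNV.
(* A pair of adjacent vertices in [S :\: N] counts once as adjacent and once as monochromatic.
   Beyond the inductive part, the left side is therefore twice the degree sum over [S :\: N], where
   each degree is at most [#|N|]. *)
have : (\sum_(x in S :\: N) deg x <= \sum_(x in S :\: N) #|N|)%N.
  apply: leq_sum => x; rewrite inE -degN => /andP[_]; exact: vmax.
have -> : (\sum_(x in S :\: N) deg x = \sum_(x in S :\: N) \sum_(y in N) G x y
   + \sum_(x in S :\: N) \sum_(y in S :\: N) G x y)%N.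
  rewrite -big_split; apply: eq_bigr => x _.
  by rewrite /deg (big_setID N) /= (setIidPr NS).
move: col0_le; lia.
Qed.

(** * Averaging, edge counting, deviations and clique embeddings *)

(** Deleting an element where [f] is largest never raises the average, so deletions down to [m]
    elements give [B]. The averages are cross-multiplied to stay in [nat]. *)
Lemma subset_sum_le_average (T : finType) (f : T -> nat) (S : {set T}) (m : nat) :
  (m <= #|S|)%N ->
  exists B : {set T}, [/\ B \subset S, #|B| = m &
    (#|S| * \sum_(x in B) f x <= m * \sum_(x in S) f x)%N].
Proof.
move: {2}(#|S| - m)%N (erefl (#|S| - m)%N) => k.
elim: k S => [|k IH] S Sk mS.
  have Sm : #|S| = m by lia.
  by exists S; rewrite Sm.
have [x0 x0S] : exists x, x \in S by apply/set0Pn; rewrite -cards_eq0; lia.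
have [v vS vmax] : exists2 v, v \in S & forall x, x \in S -> (f x <= f v)%N.
  by case: (@arg_maxnP _ x0 (mem S) f x0S) => v; exists v.
have := cardsD1 v S; rewrite vS => Sv.
have [||B [BS Bm le]] := IH (S :\ v); [lia | lia |].
exists B; split=> //; first exact: subset_trans BS (subsetDl _ _).
rewrite (big_setD1 v vS) /= mulnDr Sv mulnDl mul1n leq_add //.
rewrite -Bm -sum_nat_const; apply: leq_sum => x xB; apply: vmax.
by move: (subsetP BS _ xB); rewrite inE => /andP[].
Qed.

(** The map from ordered adjacent pairs to edges has fibres of size exactly two, as there are no
    loops. *)
Lemma handshake (T : finType) (G : sgraph T) (A : {set T}) :
  ((edges_within G A).*2 = \sum_(x in A) \sum_(y in A) G x y)%N.
Proof.
pose P (p : T * T) := (p.1 \in A) && (p.2 \in A) && G p.1 p.2.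
pose F := [set f in edges G | f \subset A].
transitivity (\sum_(p | P p) 1)%N; last first.
  rewrite pair_big /= big_mkcondr /=.
  by apply: eq_bigr => p _; case: (G _ _).
rewrite (partition_big (fun p : T * T => [set p.1; p.2]) (mem F)) /=; last first.
  move=> [x y] /andP[/andP[/= xA yA] xy]; rewrite !inE subUset !sub1set xA yA !andbT.
  by apply/existsP; exists x; apply/existsP; exists y; rewrite xy /=.
rewrite /edges_within -/F -muln2 -sum_nat_const.
apply: eq_bigr => f; rewrite !inE => /andP[/existsP[x /existsP[y /andP[xy /eqP ->]]]].
rewrite subUset !sub1set => /andP[xA yA].
have xNy : x != y by apply: contraTneq xy => ->; rewrite adj_irrefl.
have -> : 2%N = #|[set (x, y); (y, x)]|.
  by rewrite cards2 xpair_eqE negb_and xNy.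
rewrite sum1dep_card; apply: eq_card => -[u v]; rewrite !inE /P /= !xpair_eqE.
apply/idP/idP => [/orP[]/andP[/eqP -> /eqP ->]|].
- by rewrite xA yA xy eqxx.
- by rewrite xA yA adj_sym xy setUC eqxx.
case/andP=> /andP[_ uv] /eqP E.
have : u \in [set x; y] by rewrite -E !inE eqxx.
have : v \in [set x; y] by rewrite -E !inE eqxx orbT.
by rewrite !inE => /orP[]/eqP v_eq /orP[]/eqP u_eq; move: uv;
  rewrite u_eq v_eq ?adj_irrefl // !eqxx ?orbT.
Qed.

(** The right side is the sum of the squared deviations over all indices. Applied to class sizes, it
    turns a small Cauchy-Schwarz defect into near equality of the classes. *)
Lemma sqr_dev_le (r : nat) (c : 'I_r -> int) (i : 'I_r) :
  (r%:R * c i - \sum_j c j) ^+ 2 <= r%:R * (r%:R * \sum_j c j ^+ 2 - (\sum_j c j) ^+ 2).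
Proof.
set n := \sum_j c j.
have -> : r%:R * (r%:R * \sum_j c j ^+ 2 - n ^+ 2) = \sum_j (r%:R * c j - n) ^+ 2.
  have sqrE j : (r%:R * c j - n) ^+ 2 =
    r%:R ^+ 2 * c j ^+ 2 - 2 * r%:R * n * c j + n ^+ 2 by ring.
  under [RHS]eq_bigr do rewrite sqrE.
  rewrite big_split /= sumrB -!mulr_sumr sumr_const card_ord -/n -mulr_natl.
  ring.
by rewrite (bigD1 i) //= lerDl sumr_ge0 // => j _; rewrite sqr_ge0.
Qed.

(** Translates freeness into a statement on cliques listed as sequences, the form used by the
    colouring induction. Irreflexivity of [G] makes the embedding injective. *)
Lemma clique_size_neq (T : finType) (G : sgraph T) (r : nat) (s : seq T) :
  graph_free (complete_graph r) G -> pairwise G s -> size s != r.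
Proof.
move=> free s_clique; apply/eqP => s_size; apply: free.
case: s s_clique s_size => [|x0 s] s_clique s_size.
  (* Here [r] is 0 and [T] may be empty, so there is no default vertex for [nth]. *)
  have empty (i : 'I_r) : False by case: i; rewrite -s_size.
  by exists (fun i => False_rect T (empty i)); split=> i; case: (empty i).
pose f (i : 'I_r) := nth x0 (x0 :: s) i.
have fG i j : i != j -> G (f i) (f j).
  wlog ij : i j / (i < j)%N => [H iNj|_].
    have := iNj; rewrite neq_ltn => /orP[] ij; first exact: H.
    by rewrite adj_sym; apply: H; rewrite // eq_sym.
  by apply: (pairwiseP x0 s_clique) => //; rewrite inE s_size.
exists f; split=> // i j fij; apply/eqP; apply: contraT => /fG.
by rewrite fij adj_irrefl.
Qed.

Lemma exists_subset_card (T : finType) (m : nat) :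
  (m <= #|T|)%N -> exists B : {set T}, #|B| = m.
Proof.
rewrite -cardsT => mT.
by have [B [_ Bm _]] := @subset_sum_le_average T (fun=> 0%N) setT m mT; exists B.
Qed.

(** * Construction of the complement of A *)

(** The theorem for the complement [B] of A, multiplied by 2r, with (2 alpha - 1) n written as n -
    2m. The constant [8 * r ^ 2] ensures that the smallest class has at least n/(2r) >= 4rm
    vertices. *)
Lemma exists_small_side (T : finType) (G : sgraph T) (r m : nat) :
  (0 < r)%N -> (8 * r ^ 2 * m <= #|T|)%N -> graph_free (complete_graph r.+1) G ->
  exists2 B : {set T}, #|B| = m &
    (2 * r * (edges_within G B + edges_within G (~: B)) + 2 * r.-1 * m * #|T|
      <= r.-1 * #|T| ^ 2)%N.
Proof.
move=> r_gt0 m_small free; set n := #|T|.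
pose e (A B : {set T}) := (\sum_(x in A) \sum_(y in B) G x y)%N.
have e_split B : e setT setT = (e B B + (e (~: B) B).*2 + e (~: B) (~: B))%N.
  rewrite /e (sum_set2D _ (subsetT B)) ?setTD // => x y.
  by rewrite adj_sym.
have eE A : e A A = (edges_within G A).*2 by rewrite handshake.
suff [B Bm le] : exists2 B : {set T}, #|B| = m &
    (r * (e B B + e (~: B) (~: B)) + 2 * r.-1 * m * n <= r.-1 * n ^ 2)%N.
  by exists B => //; move: le; rewrite !eE; nia.
have m_le_n : (m <= n)%N by nia.
(* Since [e setT setT] is twice the number of edges, [sparse] is the case D >= (r-1)/r m n. *)
have [dense|sparse] := ltnP (r.-1 * n ^ 2) (r * e setT setT + 2 * r.-1 * m * n); last first.
  have [B Bm] := exists_subset_card m_le_n; exists B => //.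
  by move: sparse; rewrite (e_split B); nia.
have [|col [col_lt col_le]] := @coloring_of_clique_free T G r setT.
  by move=> s s_clique _; apply: clique_size_neq free s_clique.
pose V (i : 'I_r) := [set x | col x == i :> nat].
pose miss x := (\sum_y ((col x != col y) && ~~ G x y))%N.
pose cross := (\sum_(x in [set: T]) \sum_(y in [set: T]) (col x != col y))%N.
pose inner := (\sum_(x in [set: T]) \sum_(y in [set: T]) (G x y && (col x == col y)))%N.
have sumT (F : T -> nat) : (\sum_(x in [set: T]) F x = \sum_x F x)%N.
  by apply: eq_bigl => x; rewrite inE.
(* Both sides count the pairs between classes plus the inner adjacent pairs. With [col_le], the
   total of [miss] is at most twice [cross - e setT setT]. *)
have missE : (e setT setT + \sum_x miss x = cross + inner)%N.
  rewrite -sumT /e /cross /inner -!big_split; apply: eq_bigr => x _.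
  rewrite /miss -sumT -!big_split; apply: eq_bigr => y _ /=.
  by case: (G x y); case: (col x == col y).
have sumV (F : T -> nat) : (\sum_x F x = \sum_i \sum_(x in V i) F x)%N.
  rewrite (partition_big (fun x => Ordinal (col_lt x (in_setT x))) predT) //=.
  by apply: eq_bigr => i _; apply: eq_bigl => x; rewrite inE.
have card_V : (n = \sum_i #|V i|)%N.
  rewrite /n -sum1_card sumV; by apply: eq_bigr => i _; rewrite sum1_card.
have crossE : (cross + \sum_i #|V i| ^ 2 = n ^ 2)%N.
  have -> : (\sum_i #|V i| ^ 2 = \sum_x \sum_y (col x == col y))%N.
    rewrite [RHS]sumV; apply: eq_bigr => i _.
    rewrite -mulnn -sum_nat_const; apply: eq_bigr => x; rewrite inE => /eqP ->.
    by rewrite -sum1_card big_mkcond; apply: eq_bigr => y _; rewrite inE eq_sym; case: eqP.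
  rewrite /cross sumT -big_split /= -mulnn {1}/n -sum_nat_const.
  apply: eq_bigr => x _; rewrite sumT -big_split -[n]sum1_card.
  by apply: eq_bigr => y _ /=; case: eqP.
(* A smallest class: at most mn/r pairs are then lost inside it when [B] is cut off. *)
have [i Vi_le] : exists i, (r * #|V i| <= n)%N.
  have [i _ imin] := @arg_minnP _ (Ordinal r_gt0) predT (fun i => #|V i|) isT.
  exists i; rewrite -[r in (r * _)%N]card_ord -sum_nat_const card_V.
  by apply: leq_sum => j _; apply: imin.
have cross_ge : (e setT setT <= cross)%N by move: col_le; rewrite -/cross /e; lia.
have r_cross_ge : (r * e setT setT <= r * cross)%N by rewrite leq_mul2l cross_ge orbT.
have [cross_le Vi_ge] : (r * cross <= r.-1 * n ^ 2)%N /\ (n <= 2 * (r * #|V i|))%N.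
  have := @sqr_dev_le r (fun j => #|V j|%:R) i.
  under [in X in _ <= X]eq_bigr do rewrite -natrX.
  rewrite -!natr_sum -card_V.
  move: crossE; set Q := (\sum_(j < r) _)%N => crossE dev.
  (* Cauchy-Schwarz, which yields Turán's bound on [cross]. *)
  have rQ : (n ^ 2 <= r * Q)%N.
    have : 0 <= r%:R * (r%:R * Q%:R - n%:R ^+ 2) :> int.
      exact: le_trans (sqr_ge0 _) dev.
    by rewrite pmulr_rge0 ?ltr0n // subr_ge0 -natrX -natrM ler_nat.
  have r_crossE : (r * cross + r * Q = r * n ^ 2)%N by rewrite -mulnDr crossE.
  have rE : (r * n ^ 2 = r.-1 * n ^ 2 + n ^ 2)%N by rewrite -{1}(prednK r_gt0) mulSn addnC.
  split; first lia.
  (* If r|V_i| < n/2, the squared deviation of V_i exceeds n^2/4, whereas [balanced] and [dev] keep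
     it at most 2 r^2 m n <= n^2/4. *)
  rewrite leqNgt; apply/negP => small.
  have balanced : (r * Q < n ^ 2 + 2 * r * m * n)%N.
    have : (r.-1 * (m * n) <= r * (m * n))%N by rewrite leq_mul2r leq_pred orbT.
    lia.
  have dev_nat : ((n - r * #|V i|) ^ 2 + r * n ^ 2 <= r * (r * Q))%N.
    rewrite -(ler_nat int) natrD natrX natrB // !natrM; lra.
  have half : (n ^ 2 < 4 * (n - r * #|V i|) ^ 2)%N.
    by rewrite (_ : 4 = 2 ^ 2)%N // -expnMn ltn_sqr; lia.
  have : (r * (r * Q) <= r * (n ^ 2 + 2 * r * m * n))%N by rewrite leq_mul2l ltnW ?orbT.
  have : (8 * r ^ 2 * m * n <= n * n)%N by rewrite leq_mul2r m_small orbT.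
  lia.
have r2m : (4 * r * m <= #|V i|)%N.
  have : (2 * r * (4 * r * m) <= 2 * r * #|V i|)%N by lia.
  by rewrite leq_pmul2l // muln_gt0.
have m4 : (4 * m <= #|V i|)%N.
  by apply: leq_trans r2m; rewrite leq_mul2r leq_pmulr ?orbT.
have [|B [BV Bm missB]] := @subset_sum_le_average T miss (V i) m; first lia.
exists B => //.
have missV : (\sum_(x in V i) miss x <= \sum_x miss x)%N.
  by rewrite [leqRHS](bigID (mem (V i))) /= leq_addr.
(* The inner edges of V_i only help: each x in B is adjacent to the whole
   complement of V_i except for miss x vertices. *)
have cut : (m * n <= m * #|V i| + e (~: B) B + \sum_(x in B) miss x)%N.
  rewrite /e exchange_big /= -Bm -!sum_nat_const -!big_split /=.
  apply: leq_sum => x /(subsetP BV); rewrite inE => /eqP col_x.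
  rewrite /n -!sum1_card !(big_mkcond (fun y => y \in _)) /= -!big_split /=.
  apply: leq_sum => y _; rewrite !inE col_x (adj_sym G y).
  case yB: (y \in B) => /=; last by rewrite eq_sym; case: eqP; case: (G x y).
  by move: (subsetP BV _ yB); rewrite inE => ->.
(* For m = 0, [dense] would contradict Turán's bound. Positivity lets m be cancelled next. *)
have m_gt0 : (0 < m)%N.
  by rewrite lt0n; apply: contraTneq dense => ->; lia.
have missB4 : (4 * \sum_(x in B) miss x <= \sum_x miss x)%N.
  rewrite -(leq_pmul2l m_gt0) mulnCA mulnA.
  apply: (@leq_trans (#|V i| * \sum_(x in B) miss x)); first by rewrite leq_mul2r m4 orbT.
  by apply: leq_trans missB _; rewrite leq_mul2l missV orbT.
(* The factor 4 pays twice: the total of [miss] is up to twice [cross - e setT setT], and the cut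
   counts double in [e_split]. *)
have r_missB : (2 * (r * \sum_(x in B) miss x) + r * e setT setT <= r * cross)%N.
  rewrite mulnCA -mulnDr leq_mul2l; apply/orP; right.
  by move: col_le missE; rewrite -/cross -/inner /e; lia.
have r_cut := leq_mul (leqnn r) cut.
have mV : (m * (r * #|V i|) <= m * n)%N by rewrite leq_mul2l Vi_le orbT.
have rE : (r * (m * n) = r.-1 * (m * n) + m * n)%N.
  by rewrite -{1}(prednK r_gt0) mulSn addnC.
(* By [r_cut], [mV] and [rE], r times the cut is at least (r-1) m n minus r times the misses of [B];
   [r_missB] and [cross_le] absorb these misses. *)
have r_split := congr1 (muln r) (e_split B).
lia.
Qed.

Theorem theorem1p11 (R : realType) (r : nat) (r_ge1 : (1 <= r)%N) :
  exists c : R, c < 1 /\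
    forall alpha : R, c <= alpha -> alpha <= 1 ->
    forall n : nat, alpha * n%:R \is a Num.int ->
    forall (T : finType) (G : sgraph T), #|T| = n ->
      graph_free (complete_graph r.+1) G ->
    exists A : {set T},
      #|A|%:R = alpha * n%:R /\
      (edges_within G A)%:R + (edges_within G (~: A))%:R
        <= (r%:R - 1) / (2 * r%:R) * (2 * alpha - 1) * n%:R ^+ 2.
Proof.
have r_gt0 : 0 < r%:R :> R by rewrite ltr0n.
(* Chosen so that m = (1 - alpha) n satisfies 8 r^2 m <= n. *)
exists (1 - (8 * r%:R ^+ 2)^-1); split.
  by rewrite ltrBlDr ltrDl invr_gt0 mulr_gt0 ?exprn_gt0.
move=> alpha c_le alpha_le n alpha_int T G card_T free.
have r2_ge1 : 1 <= r%:R ^+ 2 :> R by rewrite exprn_ege1 // ler1n.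
have beta_le : 8 * r%:R ^+ 2 * (1 - alpha) <= 1.
  by rewrite -ler_pdivlMl ?mulr1; [lra | nra].
have alpha_ge0 : 0 <= alpha by nra.
have : alpha * n%:R \is a Num.nat.
  by rewrite natrEint alpha_int mulr_ge0.
case/natrP => k alphaE.
have kn : (k <= n)%N by rewrite -(ler_nat R) -alphaE ler_piMl.
have mE : (n - k)%:R = (1 - alpha) * n%:R :> R.
  by rewrite natrB // -alphaE; ring.
have [|B Bm le] := @exists_small_side T G r (n - k)%N r_ge1 _ free.
  rewrite card_T -(ler_nat R) !natrM mE !mulrA ler_piMl //.
  by move: beta_le; rewrite expr2 !mulrA.
exists (~: B); rewrite setCK cardsCs setCK Bm card_T subKn // alphaE; split=> //.
move: le; rewrite card_T -(ler_nat R) natrD !natrM natrD mE -subn1 natrB // => le.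
have -> : (r%:R - 1) / (2 * r%:R) * (2 * alpha - 1) * n%:R ^+ 2 =
    (r%:R - 1) * (2 * alpha - 1) * n%:R ^+ 2 / (2 * r%:R) :> R by ring.
rewrite ler_pdivlMr ?mulr_gt0 //; lra.
Qed.
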